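(* Let $p_t\in\mathbb{N}_0$ be arbitrary and $\mu\ge 0$. For $\omega_t,\alpha,\theta_t\in\mathbb{R}$ let $\hat{\mathcal S}(\omega_t,\alpha,\theta_t)\ge 0$ be defined by $$\big(\hat{\mathcal S}(\omega_t,\alpha,\theta_t)\big)^2 := (1-\omega_t)^2+2\omega_t(1-\omega_t)\,\alpha\cos(\theta_t)+\alpha^2\omega_t^2 ,$$ and let $\alpha(\theta_x,\mu):=R(-\mu\,\beta(\theta_x))$, with $R$ and $\beta$ as in the context. Then for the choice $\omega_t^\ast=\frac12$, $$\sup_{\theta_t\in[\frac{\pi}{2},\pi],\ \theta_x\in[0,\pi]}\hat{\mathcal S}(\omega_t^\ast,\alpha(\theta_x,\mu),\theta_t)\le\frac{1}{\sqrt2}.$$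
   Context: $R(z)$ is the $(p_t,p_t+1)$ subdiagonal Pad\'e approximation of $e^z$, i.e. the rational function $R=P/Q$ with $\deg P\le p_t$, $\deg Q\le p_t+1$, $Q(0)=1$ and $e^z-R(z)=O(z^{2p_t+2})$ as $z\to0$. The function $\beta$ is $\beta(\theta_x):=6\,\dfrac{1-\cos(\theta_x)}{2+\cos(\theta_x)}\in[0,12]$. The quantity defining $\hat{\mathcal S}^2$ equals $|1-\omega_t+e^{-\mathrm{i}\theta_t}\omega_t\alpha|^2$ and is therefore nonnegative. *)

(* Defs.v *)
From HB Require Import structures.
From mathcomp Require Import all_boot all_order all_algebra.
From mathcomp Require Import all_classical all_reals all_analysis.
Import Order.TTheory GRing.Theory Num.Theory.
Import numFieldNormedType.Exports.
From mathcomp Require Import ring.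

Set Implicit Arguments.
Unset Strict Implicit.
Unset Printing Implicit Defensive.

Local Open Scope classical_set_scope.
Local Open Scope ring_scope.

(* [x / 0 = 0], so the value at a zero of [Q] is a junk value. *)
Definition ratfun (K : realType) (P Q : {poly K}) (z : K) : K := P.[z] / Q.[z].

(* [size] of a polynomial is its degree plus one.  The coefficients of the
   Pade approximants of e^z are real (indeed rational), so both the
   coefficients and the variable [z -> 0] are taken real. *)
Definition subdiag_pade_exp (K : realType) (p : nat) (P Q : {poly K}) : Prop :=
  [/\ (size P <= p.+1)%N,
      (size Q <= p.+2)%N,
      Q.[0] = 1 &
      (fun z : K => expR z - ratfun P Q z) =O_ (nbhs (0 : K))
      (fun z : K => z ^+ (2 * p + 2))].

Definition beta (K : realType) (tx : K) : K := 6 * ((1 - cos tx) / (2 + cos tx)).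

Definition alpha (K : realType) (P Q : {poly K}) (tx mu : K) : K :=
  ratfun P Q (- (mu * beta tx)).

Definition Shat_sq (K : realType) (w a tt : K) : K :=
  (1 - w) ^+ 2 + 2 * w * (1 - w) * a * cos tt + a ^+ 2 * w ^+ 2.

Definition Shat (K : realType) (w a tt : K) : K := Num.sqrt (Shat_sq w a tt).

(* The right-hand side is |1 - w + e^(-i tt) w a|^2. *)
Lemma Shat_sqE (K : realType) (w a tt : K) :
  Shat_sq w a tt = (1 - w + w * a * cos tt) ^+ 2 + (w * a * sin tt) ^+ 2.
Proof. by rewrite [(_ * sin tt) ^+ 2]exprMn sin2cos2 /Shat_sq; ring. Qed.

Lemma Shat_ge0 (K : realType) (w a tt : K) : 0 <= Shat w a tt.
Proof. exact: sqrtr_ge0. Qed.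

Lemma Shat_sqr (K : realType) (w a tt : K) :
  Shat w a tt ^+ 2 = (1 - w) ^+ 2 + 2 * w * (1 - w) * a * cos tt + a ^+ 2 * w ^+ 2.
Proof. by rewrite sqr_sqrtr // Shat_sqE addr_ge0 // sqr_ge0. Qed.

(* Main.v *)
(* With c = cos tt in [-1, 0] and a = R(-x), x >= 0, the claim reads
   a^2 + 2 a c <= 1, for which -1/3 <= a <= 1 suffices.
   From Q e^z - P = O(z^(2p+2)), applying D^(p+1) gives
   (1 + D)^(p+1) Q = C z^(p+1); symmetrically P - e^(-z) Q = O(...) gives
   (D - 1)^(p+2) P = C' z^p.  Hence both polynomials solve Kummer equations, and
   comparing coefficients, with n = p + 1,
     Q(-x) = sum b_j x^j,   n P(-x) = sum (-1)^j (n - j) b_j x^j,   b_j > 0,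
   which yields R(-x) <= 1 termwise.  For the lower bound, every negative
   (odd) term of 3 n P(-x) + n Q(-x) is absorbed by halves of the two
   neighbouring even terms: 4 b_(j-1) b_(j+1) >= b_j^2. *)
Require Import Defs.
From mathcomp Require Import all_boot all_order all_algebra.
From mathcomp Require Import all_classical all_reals all_analysis.
From mathcomp Require Import ring lra zify.
Import Order.TTheory GRing.Theory Num.Theory.
Import numFieldNormedType.Exports.
Local Open Scope classical_set_scope.
Local Open Scope ring_scope.

Set Implicit Arguments.
Unset Strict Implicit.
Unset Printing Implicit Defensive.

(** * Orders of vanishing at 0 and the Taylor polynomials of exp *)

(** Letting z tend to 0 gives p(0) = 0; then a factor X is split off. The neighbourhood is punctured
    so that |z| can be cancelled at each step of the induction. *)
Lemma poly_dnbhs_bound_coef0 (K : realType) (p : {poly K}) (N : nat) (C : K) :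
  (\forall z \near (0 : K)^', `|p.[z]| <= C * `|z| ^+ N) ->
  forall i, (i < N)%N -> p`_i = 0.
Proof.
elim: N p => [//|N IH] p pC.
have p0 : p`_0 = 0.
  apply/eqP; rewrite -normr_le0 -horner_coef0.
  have pcvg : `|p.[z]| @[z --> (0 : K)^'] --> `|p.[0]|.
    apply: cvg_norm; apply/continuous_withinNx; exact: continuous_horner.
  have bcvg : `|(C%:P * 'X^(N.+1)).[z]| @[z --> (0 : K)^'] --> `|(C%:P * 'X^(N.+1)).[0]|.
    apply: cvg_norm; apply/continuous_withinNx; exact: continuous_horner.
  rewrite [leRHS](_ : 0 = `|(C%:P * 'X^(N.+1)).[0]|); last first.
    by rewrite hornerM hornerXn expr0n mulr0 normr0.
  apply: ler_cvg_to pcvg bcvg _; apply: filterS pC => z /le_trans; apply.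
  by rewrite hornerM hornerC hornerXn normrM normrX ler_wpM2r ?exprn_ge0 ?ler_norm.
have [q pE] : exists q : {poly K}, p = q * 'X.
  have /factor_theorem [q ->] : root p 0 by rewrite /root horner_coef0 p0.
  by exists q; rewrite subr0.
have qC i : (i < N)%N -> q`_i = 0.
  apply: IH; near=> z.
  have z0 : z != 0 by near: z; exact: nbhs_dnbhs_neq.
  have : `|p.[z]| <= C * `|z| ^+ N.+1 by near: z.
  by rewrite pE hornerM hornerX normrM exprSr mulrA ler_pM2r // normr_gt0.
move=> [//|i] iN; by rewrite pE coefMX /= qC.
Unshelve. all: by end_near.
Qed.

(** By the mean value theorem f(x) = f'(c) x with |c| <= |x|. The factor 1/(N+1) of integration is
    given up, so that M stays fixed when this is iterated. *)
Lemma le_norm_derive_pow (K : realType) (f df : K -> K) (M : K) (N : nat) :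
  0 <= M ->
  (forall x : K, is_derive x (1 : K) f (df x)) -> f 0 = 0 ->
  (forall x, `|x| <= 1 -> `|df x| <= M * `|x| ^+ N) ->
  forall x, `|x| <= 1 -> `|f x| <= M * `|x| ^+ N.+1.
Proof.
move=> M0 fdf f0 dfM x x1.
have fcont a b : {within `[a, b], continuous f}.
  by apply: derivable_within_continuous => y _; case: (fdf y).
have [c cx ->] : exists2 c, `|c| <= `|x| & f x = df c * x.
  have [x0|x0] := leP 0 x.
    have [c] := MVT_segment x0 (fun y _ => fdf y) (fcont _ _).
    rewrite in_itv /= f0 !subr0 => /andP[c0 cx] ->; exists c => //.
    by rewrite !ger0_norm.
  have [c] := MVT_segment (ltW x0) (fun y _ => fdf y) (fcont _ _).
  rewrite in_itv /= f0 !sub0r => /andP[cx c0] /eqP.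
  rewrite mulrN eqr_opp => /eqP ->; exists c => //.
  by rewrite (ler0_norm c0) (ltr0_norm x0) lerN2.
rewrite normrM exprSr mulrA ler_wpM2r //.
apply: le_trans (dfM _ (le_trans cx x1)) _.
by rewrite ler_wpM2l // lerXn2r // nnegrE.
Qed.

Definition exp_poly (K : realType) (N : nat) : {poly K} :=
  \poly_(k < N) (k`!%:R^-1).

Lemma deriv_exp_poly (K : realType) (N : nat) :
  (exp_poly K N.+1)^`() = exp_poly K N.
Proof.
apply/polyP => i; rewrite coef_deriv !coef_poly ltnS; case: ifP => _; last exact: mul0rn.
by rewrite factS natrM invfM -(mulr_natr (_ / _)) mulrAC mulVf ?mul1r ?pnatr_eq0.
Qed.

Lemma expR_sub_exp_poly_le (K : realType) (N : nat) (x : K) :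
  `|x| <= 1 -> `|expR x - (exp_poly K N).[x]| <= expR 1 * `|x| ^+ N.
Proof.
elim: N x => [|N IH] x x1.
  rewrite /exp_poly poly_def big_ord0 horner0 subr0 expr0 mulr1.
  rewrite ger0_norm ?expR_ge0 // ler_expR.
  exact: le_trans (ler_norm x) x1.
apply: (@le_norm_derive_pow K (fun y => expR y - (exp_poly K N.+1).[y])
  (fun y => expR y - (exp_poly K N).[y])) => //.
  move=> y; rewrite -[exp_poly K N]deriv_exp_poly; exact: is_deriveB.
by rewrite /= expR0 horner_coef0 coef_poly /= fact0 invr1 subrr.
Qed.

(** * Kummer equations from approximation by exponentials *)

(* e^(s z) (shift_deriv s A) is the derivative of e^(s z) A. *)
Definition shift_deriv (K : comNzRingType) (s : K) (A : {poly K}) : {poly K} :=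
  A^`() + s%:P * A.

(* The polynomial solutions of (D + s)^k A = c X^d, s = +-1, are the confluent
   hypergeometric polynomials solving this second order equation. *)
Definition kummer_op (K : comNzRingType) (k d : nat) (s : K) (A : {poly K}) :
    {poly K} :=
  d%:R%:P * A - 'X * A^`()
  + s%:P * ((k%:R%:P + d%:R%:P - 1) * A^`() - 'X * A^`()^`()).

Lemma coef_kummer_op (K : comNzRingType) (k d : nat) (s : K) (A : {poly K}) j :
  (kummer_op k d s A)`_j =
  (d%:R - j%:R) * A`_j + s * ((k%:R + d%:R - 1 - j%:R) * (A`_j.+1 *+ j.+1)).
Proof.
rewrite /kummer_op.
have -> : k%:R%:P + d%:R%:P - 1 = (k%:R + d%:R - 1 : K)%:P.
  by rewrite polyCB polyCD.
rewrite !(coefD, coefN, coefCM, coefXM, coef_deriv).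
by case: j => [|j] /=; ring.
Qed.

(** For s^2 = 1 the operator is d + s (k + d - 1) D - s X D (D + s). Moving D + s past X costs -s D
    (D + s), which lowers k by one. *)
Lemma shift_deriv_kummer_op (K : comNzRingType) (k d : nat) (s : K)
    (A : {poly K}) : s * s = 1 ->
  shift_deriv s (kummer_op k.+1 d s A) = kummer_op k d s (shift_deriv s A).
Proof.
move=> /(congr1 (@polyC K)); rewrite polyCM polyC1 => ss.
rewrite /shift_deriv /kummer_op -natr1 polyCD.
have d1 : (1 : {poly K})^`() = 0 by rewrite -polyC1 derivC.
rewrite polyC1 !(derivD, derivN, derivM, derivC, derivX, d1).
ring: ss.
Qed.

(** Otherwise s A = -A' would have smaller degree than A. *)
Lemma shift_deriv_inj0 (K : fieldType) (s : K) (A : {poly K}) :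
  s != 0 -> shift_deriv s A = 0 -> A = 0.
Proof.
move=> s0 A0; apply/eqP/negPn/negP => An0.
have := lt_size_deriv An0; rewrite -[size A](size_Cmul A s0).
have -> : A^`() = - (s%:P * A) by apply/eqP; rewrite -addr_eq0 -/(shift_deriv s A) A0.
by rewrite size_polyN ltnn.
Qed.

Lemma iter_shift_deriv_kummer_op (K : fieldType) (m d : nat) (s : K)
    (A : {poly K}) : s * s = 1 ->
  kummer_op 0 d s (iter m (shift_deriv s) A) = 0 -> kummer_op m d s A = 0.
Proof.
move=> ss; have s0 : s != 0.
  by apply/eqP => s0; move/eqP: ss; rewrite s0 mul0r eq_sym oner_eq0.
elim: m A => [//|m IH] A; rewrite iterSr => /IH.
by rewrite -shift_deriv_kummer_op //; apply: shift_deriv_inj0.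
Qed.

(** A is a multiple of X^d; the factor d - j vanishes at j = d and d - 1 - j at j = d - 1. *)
Lemma kummer_op_monomial (K : comNzRingType) (d : nat) (s : K) (A : {poly K}) :
  (size A <= d.+1)%N -> (forall i, (i < d)%N -> A`_i = 0) ->
  kummer_op 0 d s A = 0.
Proof.
move=> szA lowA; apply/polyP => j; rewrite coef_kummer_op coef0.
have Aj i : i != d -> A`_i = 0.
  by rewrite neq_ltn => /orP[/lowA //|di]; apply: nth_default; exact: leq_trans szA di.
have [jd|jd] := eqVneq j d; first by rewrite jd subrr mul0r Aj ?mul0rn ?mulr0 ?addr0 //; lia.
have [jd1|jd1] := eqVneq j.+1 d; last by rewrite !Aj // mul0rn !mulr0 addr0.
by rewrite Aj // mulr0 add0r -jd1 -[j.+1%:R]natr1; ring.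
Qed.

Lemma size_shift_deriv (K : comNzRingType) (s : K) (A : {poly K}) (n : nat) :
  (size A <= n)%N -> (size (shift_deriv s A) <= n)%N.
Proof.
move=> szA; apply/leq_sizeP => j nj.
have Aj := leq_trans szA nj.
by rewrite coefD coef_deriv coefCM !nth_default ?mul0rn ?mulr0 ?addr0 ?(leqW Aj).
Qed.

Lemma coef_mul_low (K : comNzRingType) (p q : {poly K}) (n i : nat) :
  (forall j, (j < n)%N -> q`_j = 0) -> (i < n)%N -> (p * q)`_i = 0.
Proof.
move=> q0 i_n; rewrite coefM big1 // => j _.
by rewrite q0 ?mulr0 //; lia.
Qed.

(** With constant term 1, q is invertible as a power series. *)
Lemma low_coef_cancel (K : comNzRingType) (p q : {poly K}) (n : nat) :
  q`_0 = 1 -> (forall i, (i < n)%N -> (p * q)`_i = 0) ->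
  forall i, (i < n)%N -> p`_i = 0.
Proof.
move=> q0 pq; elim/ltn_ind => i IH i_n.
have := pq i i_n; rewrite coefM big_ord_recr /= subnn q0 mulr1 big1 ?add0r //.
by move=> j _; rewrite IH ?mul0r //; have := ltn_ord j; lia.
Qed.

(** T stands for a truncation of e^(s z): modulo X^N, (A T)' = ((D + s) A) T. Each differentiation
    costs one order. *)
Lemma shift_deriv_order (K : comNzRingType) (s : K) (T A B : {poly K})
    (N m : nat) :
  (forall i, (i < N)%N -> (T^`() - s%:P * T)`_i = 0) ->
  (forall i, (i < N.+1)%N -> (A * T - B)`_i = 0) ->
  forall i, (i < N.+1 - m)%N -> (iter m (shift_deriv s) A * T - B^`(m))`_i = 0.
Proof.
move=> T_deriv AB; elim: m => [|m IH] i; first by rewrite subn0; exact: AB.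
move=> im; set A' := iter m _ A in IH *; set B' := B^`(m) in IH *.
have -> : iter m.+1 (shift_deriv s) A * T - B^`(m.+1)
    = (A' * T - B')^`() - A' * (T^`() - s%:P * T).
  by rewrite derivnS iterS /shift_deriv derivB derivM -/A' -/B'; ring.
rewrite coefB coef_deriv IH ?mul0rn ?sub0r //; [|lia..].
by rewrite (coef_mul_low _ T_deriv) ?oppr0 //; lia.
Qed.

(** Differentiating m times kills B and leaves (D + s)^m A = O(z^d). Its degree is at most d, so it
    is a monomial, and its equation is pulled back through (D + s)^m. *)
Lemma kummer_op_exp_approx (K : realType) (m d : nat) (s C : K) (A B : {poly K}) :
  s * s = 1 -> (0 < m + d)%N -> (size A <= d.+1)%N -> (size B <= m)%N ->
  (\forall z \near (0 : K), `|A.[z] * expR (s * z) - B.[z]| <= C * `|z| ^+ (m + d)) ->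
  kummer_op m d s A = 0.
Proof.
move=> ss md0 szA szB approx.
have s1 : `|s| = 1.
  by apply/eqP; rewrite -sqrp_eq1 // -normrX expr2 ss normr1.
pose T : {poly K} := \poly_(k < m + d) (s ^+ k / k`!%:R).
have TE z : T.[z] = (exp_poly K (m + d)).[s * z].
  rewrite !horner_poly; apply: eq_bigr => k _.
  by rewrite exprMn mulrCA mulrA.
have T_deriv i : (i < (m + d).-1)%N -> (T^`() - s%:P * T)`_i = 0.
  move=> im; rewrite coefB coef_deriv coefCM !coef_poly !ifT; [|lia..].
  rewrite factS natrM invfM exprS -[_ *+ i.+1]mulr_natr.
  have i1 : i.+1%:R != 0 :> K by rewrite pnatr_eq0.
  have i0 : i`!%:R != 0 :> K by rewrite pnatr_eq0 -lt0n fact_gt0.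
  by move: i.+1%:R i`!%:R i1 i0 => x y x0 y0; field; rewrite x0 y0.
have AT i : (i < m + d)%N -> (A * T - B)`_i = 0.
  (* Near 0, |A| <= |A(0)| + 1, and e |z|^(m + d) bounds the Taylor remainder. *)
  apply: (@poly_dnbhs_bound_coef0 _ _ _ (C + (`|A.[0]| + 1) * expR 1)).
  apply: nbhs_dnbhs; near=> z.
  have z1 : `|s * z| <= 1.
    rewrite normrM s1 mul1r; near: z.
    exact: (@nbhs0_le K K^o _ ltr01).
  have Az : `|A.[z]| <= `|A.[0]| + 1.
    near: z; apply: (@cvgr_norm_le _ _ _ _ _ _ A.[0]); last by rewrite ltrDl.
    exact: continuous_horner.
  have := expR_sub_exp_poly_le (m + d) z1; rewrite -TE normrM s1 mul1r => eT.
  have -> : (A * T - B).[z] =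
      (A.[z] * expR (s * z) - B.[z]) - A.[z] * (expR (s * z) - T.[z]).
    by rewrite hornerD hornerN hornerM; ring.
  apply: le_trans (ler_normB _ _) _; rewrite mulrDl lerD //; first by near: z.
  by rewrite normrM -mulrA ler_pM.
apply: iter_shift_deriv_kummer_op => //.
apply: kummer_op_monomial.
  by elim: {approx AT szB md0 T TE T_deriv} m => //= m; exact: size_shift_deriv.
have T0 : T`_0 = 1 by rewrite coef_poly md0 expr0 fact0 divr1.
apply: low_coef_cancel T0 _ => i id.
(* Truncation makes T' = s T hold only below order m + d - 1; the order m + d of A T - B then drops
   to d. *)
have := @shift_deriv_order _ s T A B (m + d).-1 m T_deriv.
rewrite prednK // => /(_ AT i); rewrite derivn_poly0 // subr0; apply; lia.
Unshelve. all: by end_near.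
Qed.

(** Near 0, |1 - Q| < 1, so Q has no zero there, the quotient is genuine, and |Q| <= 2. *)
Lemma pade_near (K : realType) (p : nat) (P Q : {poly K}) :
  subdiag_pade_exp p P Q ->
  exists C, \forall z \near (0 : K), `|Q.[z] * expR z - P.[z]| <= C * `|z| ^+ (2 * p + 2).
Proof.
move=> [_ _ Q0 /eqO_exP[C C0 ratC]].
exists (2 * C).
have Qcvg : Q.[z] @[z --> (0 : K)] --> (1 : K) by rewrite -Q0; exact: continuous_horner.
have Qbound : \forall z \near (0 : K), `|1 - Q.[z]| < 1.
  by by move/cvgr_dist_lt : Qcvg; apply.
near=> z.
have Qz : `|1 - Q.[z]| < 1 by near: z.
have Qz0 : Q.[z] != 0 by apply/eqP => Qz0; move: Qz; rewrite Qz0 subr0 normr1 ltxx.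
have -> : Q.[z] * expR z - P.[z] = Q.[z] * (expR z - ratfun P Q z).
  by rewrite /ratfun; field.
rewrite normrM -mulrA -normrX ler_pM //; last by near: z.
move: Qz; rewrite ltr_norml => /andP[Q1 Q2].
by rewrite ler_norml; apply/andP; split; lra.
Unshelve. all: by end_near.
Qed.

(** * Absorbing the negative terms of a sum *)

Lemma alternating_sum_ge0 (K : realFieldType) (f : nat -> K) (n : nat) :
  (forall k, (k.*2 <= n)%N -> 0 <= f k.*2) ->
  (forall k, (k.*2.+1 < n)%N -> 0 <= f k.*2 + 2 * f k.*2.+1 + f k.*2.+2) ->
  (odd n -> 0 <= f n) ->
  0 <= \sum_(j < n.+1) f j.
Proof.
move=> f_even f_triple f_odd.
(* Half of the last even term is kept in reserve for the next odd term. *)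
have half k : (k.*2 <= n)%N -> f k.*2 <= 2 * \sum_(j < k.*2.+1) f j.
  elim: k => [|k IH] kn.
    by rewrite big_ord1 /=; have := f_even _ kn; lra.
  rewrite doubleS big_ord_recr big_ord_recr /=.
  rewrite doubleS in kn.
  have := IH (ltnW (ltnW kn)); have := f_triple k kn.
  have := f_even k.+1; rewrite doubleS => /(_ kn).
  set S := \sum_(_ < _) _; lra.
rewrite -(odd_double_half n); case: (boolP (odd n)) => on /=; last first.
  rewrite add0n; have hn : (n./2.*2 <= n)%N by lia.
  by have := half _ hn; have := f_even _ hn; set S := \sum_(_ < _) _; lra.
have hn : (n./2.*2 <= n)%N by lia.
rewrite big_ord_recr /=; have := half _ hn; have := f_even _ hn.
have := f_odd on; rewrite -{1}(odd_double_half n) on /= add1n.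
by set S := \sum_(_ < _) _; lra.
Qed.

(* J is an odd index and m = n - J with n = p + 1, so n + 3 m = J + 4 m and
   n - 3 m = J - 2 m; (m + 1, m - 1) belong to the neighbouring indices. *)
Lemma pade_triple_ge0 (K : realFieldType) (J m b0 b1 b2 x : K) :
  1 <= J -> 1 <= m -> 0 <= x -> 0 < b0 -> 0 < b1 -> 0 < b2 ->
  (m + 1) * b0 = (J + 2 * m) * (J * b1) ->
  m * b1 = (J + 2 * m - 1) * ((J + 1) * b2) ->
  0 <= (J + 4 * m + 3) * b0 + 2 * ((J - 2 * m) * b1) * x
       + (J + 4 * m - 3) * b2 * x ^+ 2.
Proof.
move=> J1 m1 x0 b00 b10 b20 rec0 rec2.
set al := (J + 4 * m + 3) * b0; set be := (J - 2 * m) * b1.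
set ga := (J + 4 * m - 3) * b2.
have al0 : 0 <= al by apply: mulr_ge0; lra.
have ga0 : 0 < ga by apply: mulr_gt0; lra.
have [Jm|Jm] := leP (2 * m) J.
  have be0 : 0 <= be by apply: mulr_ge0; lra.
  have := mulr_ge0 be0 x0; have := mulr_ge0 (ltW ga0) (exprn_ge0 2 x0).
  by move: al be ga al0 {ga0 be0} => al be ga; lra.
have disc : be ^+ 2 <= al * ga.
  (* D clears the denominators of both recurrences: D b0 b2 = (J + 2 m) J m b1^2. *)
  pose D := (m + 1) * ((J + 2 * m - 1) * (J + 1)).
  have D0 : 0 < D by rewrite !mulr_gt0 //; lra.
  rewrite -(ler_pM2l D0).
  have -> : D * (al * ga)
      = (J + 4 * m + 3) * (J + 4 * m - 3) * ((m + 1) * b0)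
        * ((J + 2 * m - 1) * ((J + 1) * b2)) by rewrite /D /al /ga; ring.
  rewrite rec0 -rec2.
  have -> : (J + 4 * m + 3) * (J + 4 * m - 3) * ((J + 2 * m) * (J * b1)) * (m * b1)
      = ((J + 2 * m) * J * m) * ((J + 4 * m + 3) * (J + 4 * m - 3)) * b1 ^+ 2 by ring.
  rewrite /be exprMn [leLHS]mulrA ler_pM2r ?exprn_gt0 //.
  (* Factorwise: m + 1 <= 2 m, J + 2 m - 1 <= J + 2 m and J + 1 <= 2 J. *)
  have D4 : D <= 4 * ((J + 2 * m) * J * m).
    have -> : 4 * ((J + 2 * m) * J * m) = (2 * m) * ((J + 2 * m) * (2 * J)) by ring.
    by rewrite /D !ler_pM ?mulr_ge0 //; lra.
  apply: (@le_trans _ _ (4 * ((J + 2 * m) * J * m) * (J - 2 * m) ^+ 2)).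
    by rewrite ler_wpM2r // sqr_ge0.
  have -> : 4 * ((J + 2 * m) * J * m) * (J - 2 * m) ^+ 2
    = (J + 2 * m) * J * m * (2 * (2 * m - J)) ^+ 2 by ring.
  rewrite ler_wpM2l ?mulr_ge0 //; [lra..|].
  have -> : (J + 4 * m + 3) * (J + 4 * m - 3) = (J + 4 * m) ^+ 2 - 9 by ring.
  (* Here 0 < 2 (2 m - J) <= J + 4 m - 3, because J >= 1. *)
  apply: (@le_trans _ _ ((J + 4 * m - 3) ^+ 2)); first by rewrite lerXn2r ?nnegrE; lra.
  nra.
rewrite -(pmulr_rge0 _ ga0).
have -> : ga * (al + 2 * be * x + ga * x ^+ 2)
  = (ga * x + be) ^+ 2 + (al * ga - be ^+ 2) by ring.
by rewrite addr_ge0 ?sqr_ge0 // subr_ge0.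
Qed.

(** * Coefficients of the Pade approximant and its bounds on the negative axis *)

Section SubdiagonalPade.
Variables (K : realType) (p : nat) (P Q : {poly K}).
Hypothesis padePQ : subdiag_pade_exp p P Q.

Lemma pade_num_coef0 : P`_0 = 1.
Proof.
have [_ _ Q0 _] := padePQ.
have [C /nbhs_singleton] := pade_near padePQ.
rewrite Q0 expR0 mul1r normr0 expr0n addn2 mulr0 normr_le0 subr_eq0 => /eqP.
by rewrite horner_coef0.
Qed.

Lemma pade_den_rec j :
  (p.+1%:R - j%:R) * Q`_j
  + (2 * p.+1%:R - 1 - j%:R) * (j.+1%:R * Q`_j.+1) = 0.
Proof.
have [szP szQ _ _] := padePQ.
have [C PQ] := pade_near padePQ.
have : kummer_op p.+1 p.+1 1 Q = 0.
  apply: (@kummer_op_exp_approx _ _ _ _ C _ P) => //; first by rewrite mulr1.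
  apply: filterS PQ => z; rewrite mul1r.
  by have -> : (2 * p + 2 = p.+1 + p.+1)%N by lia.
move/(congr1 (fun A : {poly K} => A`_j)); rewrite coef_kummer_op coef0 => H.
by rewrite -[RHS]H -[Q`_j.+1 *+ _]mulr_natl; ring.
Qed.

(** Since m + d = 2 p + 2 for P as well as for Q, the factor 2 n - 1 - j is common to both
    recurrences. *)
Lemma pade_num_rec j :
  (p%:R - j%:R) * P`_j
  = (2 * p.+1%:R - 1 - j%:R) * (j.+1%:R * P`_j.+1).
Proof.
have [szP szQ _ _] := padePQ.
have [C PQ] := pade_near padePQ.
have : kummer_op p.+2 p (-1) P = 0.
  (* The bound is multiplied by e^(-z), which is at most e for |z| <= 1. *)
  apply: (@kummer_op_exp_approx _ _ _ _ (expR 1 * C) _ Q) => //.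
    by rewrite mulrNN mulr1.
  near=> z.
  have -> : P.[z] * expR (-1 * z) - Q.[z]
      = - expR (- z) * (Q.[z] * expR z - P.[z]).
    by rewrite mulN1r expRN; field; rewrite gt_eqF ?expR_gt0.
  have -> : (p.+2 + p = 2 * p + 2)%N by lia.
  rewrite normrM normrN -mulrA ler_pM //; last by near: z.
  rewrite ger0_norm ?expR_ge0 // ler_expR.
  apply: le_trans (ler_norm _) _; rewrite normrN; near: z.
  exact: (@nbhs0_le K K^o _ ltr01).
move/(congr1 (fun A : {poly K} => A`_j)); rewrite coef_kummer_op coef0.
rewrite -[P`_j.+1 *+ _]mulr_natl => /eqP; rewrite addr_eq0 => /eqP.
by move=> ->; rewrite -[p.+2%:R]natr1; ring.
Unshelve. all: by end_near.
Qed.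

Let b j := (-1) ^+ j * Q`_j.

Lemma pade_den_sign_rec j :
  (p.+1%:R - j%:R) * b j = (2 * p.+1%:R - 1 - j%:R) * (j.+1%:R * b j.+1).
Proof.
have /(congr1 ( *%R ((-1) ^+ j))) := pade_den_rec j; rewrite mulr0 => H.
by apply/eqP; rewrite -subr_eq0 -[X in _ == X]H /b exprS; apply/eqP; ring.
Qed.

Lemma pade_den_sign_gt0 j : (j <= p.+1)%N -> 0 < b j.
Proof.
have [_ _ Q0 _] := padePQ.
elim: j => [_|j IH jp]; first by rewrite /b expr0 mul1r -horner_coef0 Q0 ltr01.
have bj := IH (ltnW jp).
have jK : j.+1%:R <= p.+1%:R :> K by rewrite ler_nat.
have j0 : 0 <= j%:R :> K by [].
have dj : 0 < (2 * p.+1%:R - 1 - j%:R) * j.+1%:R :> K.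
  by rewrite mulr_gt0 ?ltr0Sn //; move: jK; rewrite -!natr1; have : 0 <= p%:R :> K by []; lra.
rewrite -(pmulr_rgt0 _ dj) -mulrA -pade_den_sign_rec mulr_gt0 // subr_gt0.
by rewrite ltr_nat.
Qed.

(** The recurrences give successive quotients of P_j / b_j equal to (n - j - 1) / (n - j), whose
    product telescopes to (n - j) / n. *)
Lemma pade_num_den_coef j :
  (j <= p.+1)%N -> p.+1%:R * P`_j = (p.+1%:R - j%:R) * b j.
Proof.
have [_ _ Q0 _] := padePQ.
elim: j => [_|j IH jp].
  by rewrite pade_num_coef0 /b -horner_coef0 Q0 expr0 !mulr1 subr0.
have dj : (2 * p.+1%:R - 1 - j%:R) * j.+1%:R != 0 :> K.
  rewrite gt_eqF // mulr_gt0 ?ltr0Sn //.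
  have : j.+1%:R <= p.+1%:R :> K by rewrite ler_nat.
  by rewrite -!natr1; have : 0 <= p%:R :> K by []; lra.
apply: (mulfI dj).
have -> : (2 * p.+1%:R - 1 - j%:R) * j.+1%:R * (p.+1%:R * P`_j.+1)
  = p.+1%:R * ((2 * p.+1%:R - 1 - j%:R) * (j.+1%:R * P`_j.+1)) by ring.
rewrite -pade_num_rec.
have -> : (2 * p.+1%:R - 1 - j%:R) * j.+1%:R * ((p.+1%:R - j.+1%:R) * b j.+1)
  = (p.+1%:R - j.+1%:R) * ((2 * p.+1%:R - 1 - j%:R) * (j.+1%:R * b j.+1)) by ring.
rewrite -pade_den_sign_rec mulrCA IH 1?ltnW //.
by rewrite -!natr1; ring.
Qed.

Lemma pade_den_hornerN x : Q.[- x] = \sum_(j < p.+2) b j * x ^+ j.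
Proof.
have [_ szQ _ _] := padePQ.
rewrite (horner_coef_wide _ szQ); apply: eq_bigr => j _.
by rewrite [in LHS]exprNn /b; ring.
Qed.

Lemma pade_num_hornerN x :
  p.+1%:R * P.[- x]
  = \sum_(j < p.+2) (-1) ^+ j * ((p.+1%:R - j%:R) * b j) * x ^+ j.
Proof.
have [szP _ _ _] := padePQ.
rewrite (@horner_coef_wide _ p.+2 _ _ (leqW szP)) mulr_sumr; apply: eq_bigr => j _.
have jp : (j <= p.+1)%N by rewrite -ltnS.
by rewrite -(pade_num_den_coef jp) [in LHS]exprNn; ring.
Qed.

Lemma pade_den_hornerN_gt0 x : 0 <= x -> 0 < Q.[- x].
Proof.
move=> x0; rewrite pade_den_hornerN big_ord_recl /= ltr_pwDl //.
  by rewrite expr0 mulr1 pade_den_sign_gt0.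
apply: sumr_ge0 => j _; rewrite mulr_ge0 ?exprn_ge0 // ltW //.
by rewrite pade_den_sign_gt0.
Qed.

Lemma pade_hornerN_le1 x : 0 <= x -> ratfun P Q (- x) <= 1.
Proof.
move=> x0; rewrite /ratfun ler_pdivrMr ?pade_den_hornerN_gt0 // mul1r.
rewrite -(@ler_pM2l _ p.+1%:R) ?ltr0Sn //.
rewrite pade_num_hornerN pade_den_hornerN mulr_sumr; apply: ler_sum => j _.
have jp : j%:R <= p.+1%:R :> K by rewrite ler_nat -ltnS.
rewrite [leRHS]mulrA ler_wpM2r ?exprn_ge0 // mulrA ler_wpM2r //.
  by rewrite ltW // pade_den_sign_gt0 // -ltnS.
have j0 : 0 <= j%:R :> K by [].
by rewrite -signr_odd; case: (odd j); rewrite ?expr1 ?expr0; lra.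
Qed.

(** Any lower bound not below 1 - sqrt 2 would serve the theorem; -1/3 is a convenient rational
    one. *)
Lemma pade_hornerN_ge x : 0 <= x -> - (1 / 3) <= ratfun P Q (- x).
Proof.
move=> x0; rewrite /ratfun ler_pdivlMr ?pade_den_hornerN_gt0 //.
suff : 0 <= 3 * (p.+1%:R * P.[- x]) + p.+1%:R * Q.[- x].
  have n0 : 0 < p.+1%:R :> K by rewrite ltr0Sn.
  have -> : 3 * (p.+1%:R * P.[- x]) + p.+1%:R * Q.[- x]
      = p.+1%:R * (3 * P.[- x] + Q.[- x]) by ring.
  by rewrite pmulr_rge0 //; lra.
rewrite pade_num_hornerN pade_den_hornerN !mulr_sumr -big_split /=.
pose f j := (p.+1%:R + 3 * (-1) ^+ j * (p.+1%:R - j%:R)) * b j * x ^+ j.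
rewrite (eq_bigr (fun j : 'I_p.+2 => f j)); last by move=> j _; rewrite /f; ring.
have b0 j : (j <= p.+1)%N -> 0 < b j := @pade_den_sign_gt0 j.
apply: alternating_sum_ge0 => [k kn|k kn|on].
- rewrite /f -signr_odd odd_double expr0 mulr1.
  have kK : k.*2%:R <= p.+1%:R :> K by rewrite ler_nat.
  have n0 : 0 <= p.+1%:R :> K by [].
  by rewrite mulr_ge0 ?exprn_ge0 // mulr_ge0 ?(ltW (b0 _ kn)) //; lra.
- have k1 := ltnW kn; have k0 := ltnW k1.
  pose m : K := p.+1%:R - k.*2.+1%:R; pose J : K := k.*2.+1%:R.
  have m1 : 1 <= m.
    by rewrite /m lerBrDr addrC natr1 ler_nat.
  have J1 : 1 <= J by rewrite /J ler1n.
  have n_mJ : p.+1%:R = m + J by rewrite /m /J; ring.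
  have kJ : k.*2%:R = J - 1 by rewrite /J -natr1; ring.
  have rec0 := pade_den_sign_rec k.*2; have rec2 := pade_den_sign_rec k.*2.+1.
  have kJ1 : k.*2.+2%:R = J + 1 by rewrite natr1.
  rewrite -/J n_mJ kJ in rec0; rewrite -/J kJ1 n_mJ in rec2.
  have -> : f k.*2 + 2 * f k.*2.+1 + f k.*2.+2 =
    x ^+ k.*2 * ((J + 4 * m + 3) * b k.*2 + 2 * ((J - 2 * m) * b k.*2.+1) * x +
       (J + 4 * m - 3) * b k.*2.+2 * x ^+ 2).
    rewrite /f kJ -/J kJ1 n_mJ !exprS -signr_odd odd_double expr0; ring.
  rewrite mulr_ge0 ?exprn_ge0 //.
  by apply: (pade_triple_ge0 J1 m1 x0 (b0 _ k0) (b0 _ k1) (b0 _ kn)); lra.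
(* At j = n the contribution of P vanishes, leaving n b_n x^n. *)
- rewrite /f subrr mulr0 addr0 mulr_ge0 ?exprn_ge0 //.
  by rewrite mulr_ge0 ?ler0n // ltW ?b0.
Qed.
End SubdiagonalPade.

(** * The bound on the smoothing factor *)

Lemma beta_ge0 (K : realType) (tx : K) : 0 <= beta tx.
Proof.
have := cos_le1 tx; have := cos_geN1 tx => c1 c2.
by rewrite /beta mulr_ge0 // divr_ge0 //; lra.
Qed.

Lemma cos_le0_pihalf_pi (K : realType) (t : K) : pi / 2 <= t <= pi -> cos t <= 0.
Proof.
move=> /andP[t1 t2]; rewrite -[t](subrK pi) cosDpi oppr_le0.
by apply: cos_ge0_pihalf; apply/andP; split; have := pi_ge0 K; lra.
Qed.

Theorem lemma3p10 (K : realType) (p_t : nat) (mu : K) (P Q : {poly K})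
    (mu_ge0 : 0 <= mu) (padePQ : subdiag_pade_exp p_t P Q) :
  (ereal_sup [set (Shat (1 / 2)%R (alpha P Q tx mu) tt)%:E
               | tt in `[(pi / 2)%R, pi] & tx in `[0%R, pi]]
   <= (1 / Num.sqrt 2)%:E)%E.
Proof.
apply: ge_ereal_sup => y [tt /=]; rewrite in_itv /= => tt_itv [tx _ <-] {y}.
rewrite lee_fin /alpha; set x := mu * beta tx.
have x0 : 0 <= x by rewrite mulr_ge0 ?beta_ge0.
have := pade_hornerN_ge padePQ x0; have := pade_hornerN_le1 padePQ x0.
set a := ratfun P Q _ => a1 a3.
have c0 := cos_le0_pihalf_pi tt_itv; have c1 := cos_geN1 tt.
rewrite /Shat [leRHS]div1r -sqrtrV ?ler0n //.
apply: ler_wsqrtr; rewrite /Shat_sq.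
(* For w = 1/2, four times [Shat_sq] is 1 + 2 a c + a^2, which must not exceed 2. *)
suff : a ^+ 2 + 2 * (a * cos tt) <= 1 by lra.
have [a0|a0] := leP 0 a.
  have a2 : a ^+ 2 <= 1 by rewrite exprn_ile1.
  have : a * cos tt <= 0 by rewrite mulr_ge0_le0.
  by lra.
(* For a < 0 the worst case is c = -1, where a^2 - 2 a <= 7/9 by a >= -1/3. *)
by nra.
Qed.
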